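(* Let $K$ be a rational partial polytopal complex in $\mathbb{R}^n$ of dimension $d$, and let $m$ be a positive integer such that $mK$ is integral. Let $p_0,\ldots,p_{m-1}$ be the polynomials of degree at most $d$ with $L_K(km+l)=p_l(k)$ for all integers $k\geq0$, $0\leq l<m$, $(k,l)\neq(0,0)$. Then the $f^*$-vector $f^*(L_K,d,m)=\big(f^*_i(p_l,d)\big)_{0\leq i\leq d,\ 0\leq l<m}$ has only non-negative integer entries.
   Context: A rational partial polytopal complex is a finite disjoint union $K$ of relatively open polytopes (relative interiors of convex hulls of finitely many points) whose vertices are in $\mathbb{Q}^n$; its dimension is the maximal dimension of these open polytopes; $mK$ is integral if all vertices of all the dilated open polytopes lie in $\mathbb{Z}^n$. The Ehrhart function is $L_K(k)=\#(\mathbb{Z}^n\cap kK)$ for integers $k\geq1$; when $mK$ is integral, polynomials $p_0,\ldots,p_{m-1}$ of degree at most $d$ as in the claim exist and are unique. For a polynomial $p$ of degree at most $d$, $f^*(p,d)=(f^*_0(p,d),\ldots,f^*_d(p,d))$ is the unique vector with $p(k)=\sum_{i=0}^d f^*_i(p,d)\binom{k-1}{i}$, where $\binom{x}{i}=x(x-1)\cdots(x-i+1)/i!$. *)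

(* Defs.v *)
From HB Require Import structures.
From mathcomp Require Import all_boot all_order all_algebra finmap.
From mathcomp Require Import mathcomp_extra boolp classical_sets functions.
From mathcomp Require Import cardinality reals topology normedtype.

Set Implicit Arguments.
Unset Strict Implicit.
Unset Printing Implicit Defensive.

Import Order.TTheory GRing.Theory Num.Theory.
Import numFieldNormedType.Exports.

Local Open Scope classical_set_scope.
Local Open Scope ring_scope.

Section Polytopes.
Variables (R : realType) (n : nat).
Implicit Types (A P : set 'rV[R]_n) (x : 'rV[R]_n).

Definition affine_hull A : set 'rV[R]_n :=
  [set x | exists (N : nat) (v : 'I_N -> 'rV[R]_n) (a : 'I_N -> R),
    [/\ forall i, A (v i), \sum_i a i = 1 & x = \sum_i a i *: v i]].

Definition convex_hull A : set 'rV[R]_n :=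
  [set x | exists (N : nat) (v : 'I_N -> 'rV[R]_n) (a : 'I_N -> R),
    [/\ forall i, A (v i), forall i, 0 <= a i, \sum_i a i = 1
      & x = \sum_i a i *: v i]].

Definition polytope P : Prop :=
  exists V : seq 'rV[R]_n, P = convex_hull [set` V].

(* The interior of P in the subspace topology of its affine hull. *)
Definition relint P : set 'rV[R]_n :=
  [set x | P x /\ within (affine_hull P) (nbhs x) P].

(* Vertices are the extreme points. *)
Definition vertices P : set 'rV[R]_n :=
  [set x | P x /\ forall y z (t : R), P y -> P z -> 0 < t < 1 ->
    x = t *: y + (1 - t) *: z -> y = x /\ z = x].

(* The affine hull is a translate of a d-dimensional linear subspace, given as
   the row space of U. The empty set has no dimension in this sense. *)
Definition has_dim P (d : nat) : Prop :=
  exists (x0 : 'rV[R]_n) (U : 'M[R]_n),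
    \rank U = d /\ affine_hull P = [set x | (x - x0 <= U)%MS].

Definition dilate (k : nat) A : set 'rV[R]_n := [set k%:R *: x | x in A].

Definition integer_points : set 'rV[R]_n :=
  [set x | forall j, x ord0 j \is a Num.int].

Definition rational_points : set 'rV[R]_n :=
  [set x | forall j, rational (x ord0 j)].

End Polytopes.

(* The cells are closed polytopes; the complex is the disjoint union of their
   relative interiors. The decomposition is part of the data, since the
   vertices depend on it. *)
Record partial_polytopal_complex (R : realType) (n : nat) := PPComplex {
  ncells : nat;
  cell : 'I_ncells -> set 'rV[R]_n;
  cell_polytope : forall i, polytope (cell i);
  cell_disjoint : trivIset [set: 'I_ncells] (fun i => relint (cell i)) }.

Section Complexes.
Variables (R : realType) (n : nat) (K : partial_polytopal_complex R n).

Definition support : set 'rV[R]_n :=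
  \bigcup_(i in [set: 'I_(ncells K)]) relint (cell i).

Definition rational_complex : Prop :=
  forall i : 'I_(ncells K), vertices (cell i) `<=` @rational_points R n.

Definition complex_dim (d : nat) : Prop :=
  (exists i : 'I_(ncells K), has_dim (cell i) d) /\
  (forall (i : 'I_(ncells K)) (e : nat), has_dim (cell i) e -> (e <= d)%N).

Definition integral_dilate (m : nat) : Prop :=
  forall i : 'I_(ncells K),
    vertices (dilate m (cell i)) `<=` @integer_points R n.

(* [fset_set] is junk (empty) on infinite sets, but the set here is bounded,
   hence finite. *)
Definition ehrhart (k : nat) : nat :=
  #|` fset_set (@integer_points R n `&` dilate k support)|.

End Complexes.

Section FStar.
Variable R : realType.

Definition gbinom (x : R) (i : nat) : R :=
  (\prod_(j < i) (x - j%:R)) / i`!%:R.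

Definition is_fstar (p : {poly R}) (d : nat) (f : 'rV[R]_d.+1) : Prop :=
  forall x : R, p.[x] = \sum_(i < d.+1) f ord0 i * gbinom (x - 1) i.

(* The unique vector satisfying [is_fstar] when p has degree at most d; see
   [is_fstar_exists] and [is_fstar_unique]. *)
Definition fstar (p : {poly R}) (d : nat) : 'rV[R]_d.+1 :=
  xget 0 [set f | is_fstar p f].

Lemma is_fstar_exists (p : {poly R}) (d : nat) :
  (size p <= d.+1)%N -> exists f : 'rV[R]_d.+1, is_fstar p f.
Proof.
suff H k : (size p <= k)%N -> exists f : nat -> R,
    forall x, p.[x] = \sum_(i < k) f i * gbinom (x - 1) i.
  move=> /H [f Hf]; exists (\row_i f i) => x.
  by rewrite Hf; apply: eq_bigr => i _; rewrite mxE.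
elim: k p => [|k IH] p sp.
  exists (fun=> 0) => x.
  by move: sp; rewrite leqn0 size_poly_eq0 => /eqP ->; rewrite horner0 big_ord0.
pose b : {poly R} := \prod_(j < k) ('X - (1 + j%:R)%:P).
have sb : size b = k.+1.
  by rewrite size_prod_XsubC -[index_enum _]enumT size_enum_ord.
have bk : b`_k = 1.
  have /monicP : b \is monic by apply: monic_prod_XsubC.
  by rewrite lead_coefE sb.
have /IH [f Hf] : (size (p - p`_k *: b)%R <= k)%N.
  apply/leq_sizeP => j; rewrite leq_eqVlt => /predU1P[<-|kj].
    by rewrite coefB coefZ bk mulr1 subrr.
  rewrite coefB coefZ [p`_j]nth_default ?(leq_trans sp) //.
  by rewrite [b`_j]nth_default ?sb // mulr0 subrr.
exists (fun i => if i == k then p`_k * k`!%:R else f i) => x.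
rewrite big_ord_recr /= eqxx.
under eq_bigr => i _ do rewrite (ltn_eqF (ltn_ord i)).
rewrite -Hf hornerD hornerN hornerZ /gbinom.
have -> : \prod_(j < k) (x - 1 - j%:R) = b.[x].
  by rewrite horner_prod; apply: eq_bigr => j _; rewrite hornerXsubC opprD addrA.
have kf : k`!%:R != 0 :> R by rewrite pnatr_eq0 -lt0n fact_gt0.
by rewrite -mulrA [k`!%:R * _]mulrC divfK // subrK.
Qed.

Lemma is_fstar_unique (p : {poly R}) (d : nat) (f g : 'rV[R]_d.+1) :
  is_fstar p f -> is_fstar p g -> f = g.
Proof.
move=> hf hg; apply/rowP => i0.
have gb0 (a b : nat) : (a < b)%N -> gbinom a%:R b = 0.
  move=> ab; rewrite /gbinom (bigD1 (Ordinal ab)) //= subrr !mul0r //.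
have gbd (a : nat) : gbinom a%:R a != 0.
  rewrite /gbinom mulf_neq0 //; last first.
    by rewrite invr_neq0 // pnatr_eq0 -lt0n fact_gt0.
  by apply/prodf_neq0 => j _; rewrite subr_eq0 eqr_nat gtn_eqF.
have [k ik] : exists k, (i0 <= k)%N by exists i0.
elim: k i0 ik => [|k IH] i0 ik.
all: have := hf (1 + i0%:R); rewrite (hg (1 + i0%:R)) [1 + _]addrC addrK.
all: rewrite [in X in X = _ -> _](bigD1 i0) // [in X in _ = X -> _](bigD1 i0) //=.
all: have -> : \sum_(i < d.+1 | i != i0) f ord0 i * gbinom i0%:R i =
   \sum_(i < d.+1 | i != i0) g ord0 i * gbinom i0%:R i.
1,3: apply: eq_bigr => i ii0; case: (ltngtP i i0) => h.
all: try by rewrite gb0 // !mulr0.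
all: try by move/val_inj: h ii0 => ->; rewrite eqxx.
- by move: (leq_trans h ik); rewrite ltn0.
- by rewrite IH // -ltnS (leq_trans h).
all: by move=> /addIr /(mulIf (gbd _)).
Qed.

End FStar.

(* Main.v *)
(** Since p_l has degree at most d, f^*(p_l, d) is the sequence of Newton
coefficients of k |-> L_K((k + 1) m + l), so it is enough to show that the
latter is a natural combination of the binomials 'C(k, j). This may be done
cell by cell. A cell P is the convex hull of its vertices. Assigning to each
point of P its lexicographically largest coefficient vector with respect to
the vertices partitions P into open simplices, and one that meets relint P
lies in it. The lattice points in the cone over an open simplex are uniquely
a lattice point of the fundamental parallelepiped with coefficients in (0, 1]
plus a natural combination of the generators. For a simplex with e vertices
a parallelepiped point of height h m + l has h <= e, and it contributes
'C(k + (e - h), e - 1) points at height (k + 1) m + l, which by Vandermonde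
is a natural combination of the 'C(k, j). *)
Require Import Defs.
From HB Require Import structures.
From mathcomp Require Import all_boot all_order all_algebra finmap.
From mathcomp Require Import lra zify.
From mathcomp Require Import boolp classical_sets cardinality.
From mathcomp Require Import reals topology normedtype.

Set Implicit Arguments.
Unset Strict Implicit.
Unset Printing Implicit Defensive.

Import Order.TTheory GRing.Theory Num.Theory.
Import numFieldNormedType.Exports.

Local Open Scope ring_scope.

(** * Lexicographic triangulation: a canonical coefficient vector for each point of a cone *)

Section LexTriangulation.
Variables (R : realFieldType) (N n : nat) (U : 'M[R]_(N, n)).
Implicit Types (b c : 'rV[R]_N) (S : {set 'I_N}).

Definition lexpos c : Prop :=
  exists i : 'I_N, 0 < c 0 i /\ forall j : 'I_N, (j < i)%N -> c 0 j = 0.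

Definition nonneg b : Prop := forall i, 0 <= b 0 i.

Definition supp b : {set 'I_N} := [set i | b 0 i != 0].

(** An affine dependency between the rows of [U]. *)
Definition dependency c : Prop := c *m U = 0 /\ \sum_i c 0 i = 0.

(* [S] is the support of the lexicographically largest nonnegative coefficient
   vector of every point of the open simplex it spans. *)
Definition admissible S : Prop :=
  forall c, dependency c -> (forall i, i \notin S -> 0 <= c 0 i) -> ~ lexpos c.

Lemma lexpos_trichotomy c : [\/ c = 0, lexpos c | lexpos (- c)].
Proof.
have [->|c0] := eqVneq c 0; first by constructor 1.
have [i0 ci0] : exists i, c 0 i != 0.
  apply/existsP; apply: contraNT c0 => /existsPn H.
  by apply/eqP/rowP => i; rewrite mxE; apply/eqP; rewrite -[_ == _]negbK H.
have [i ci imin] := @arg_minnP 'I_N i0 (fun i => c 0 i != 0) val ci0.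
have z (j : 'I_N) : (j < i)%N -> c 0 j = 0.
  move=> ji; apply/eqP/negPn/negP => /imin; by rewrite leqNgt ji.
case: (ltgtP (c 0 i) 0) ci => // h _; [constructor 3|constructor 2]; exists i.
  by rewrite !mxE oppr_gt0; split=> // j /z; rewrite !mxE => ->; rewrite oppr0.
by split.
Qed.

Lemma lexposD b c : lexpos b -> lexpos c -> lexpos (b + c).
Proof.
move=> [i [bi zi]] [j [cj zj]].
case: (ltngtP i j) => [ij|ji|/val_inj ij].
- exists i; rewrite mxE (zj _ ij) addr0; split=> // k ki.
  by rewrite mxE zi // zj ?addr0 // (ltn_trans ki).
- exists j; rewrite mxE (zi _ ji) add0r; split=> // k kj.
  by rewrite mxE zj // zi ?addr0 // (ltn_trans kj).
- subst j; exists i; rewrite mxE addr_gt0 //; split=> // k ki.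
  by rewrite mxE zi // zj // addr0.
Qed.

Lemma lexposZ e c : 0 < e -> lexpos c -> lexpos (e *: c).
Proof.
move=> e0 [i [ci zi]]; exists i; rewrite mxE mulr_gt0 //; split=> // j /zi.
by rewrite mxE => ->; rewrite mulr0.
Qed.

Lemma lexpos0 : ~ lexpos 0.
Proof. by move=> [i [+ _]]; rewrite mxE ltxx. Qed.

Lemma dependencyZ e c : dependency c -> dependency (e *: c).
Proof.
move=> [cU c0]; split; first by rewrite -scalemxAl cU scaler0.
under eq_bigr do rewrite mxE.
by rewrite -mulr_sumr c0 mulr0.
Qed.

Lemma dependencyB b c : b *m U = c *m U -> \sum_i b 0 i = \sum_i c 0 i ->
  dependency (b - c).
Proof.
move=> bc s; split; first by rewrite mulmxBl bc subrr.
under eq_bigr do rewrite !mxE.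
by rewrite big_split sumrN /= s subrr.
Qed.

(** The difference [b - c] is a dependency that is nonnegative outside [supp c], so it cannot be
    lexicographically positive; by symmetry neither can [c - b]. *)
Lemma admissible_inj b c : nonneg b -> nonneg c ->
  admissible (supp b) -> admissible (supp c) ->
  b *m U = c *m U -> \sum_i b 0 i = \sum_i c 0 i -> b = c.
Proof.
move=> b0 c0 bA cA bc s.
apply/eqP; rewrite -subr_eq0; apply/eqP.
case: (lexpos_trichotomy (b - c)) => // h.
- case: (cA (b - c)) => //; first exact: dependencyB.
  by move=> i; rewrite !inE negbK !mxE => /eqP ->; rewrite subr0.
- case: (bA (c - b)) => //; first exact: dependencyB.
    by move=> i; rewrite !inE negbK !mxE => /eqP ->; rewrite subr0.
  by rewrite -opprB.
Qed.

Lemma exists_small_step b c : nonneg b ->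
  (forall i, c 0 i < 0 -> 0 < b 0 i) ->
  exists2 e : R, 0 < e & nonneg (b + e *: c).
Proof.
move=> b0 cb.
(* [w i] is the longest step that keeps coordinate [i] nonnegative; 1 stands in where [c] does not
   decrease it. *)
pose w i := if c 0 i < 0 then b 0 i / - c 0 i else 1.
have w0 i : 0 < w i.
  by rewrite /w; case: ifP => // h; rewrite divr_gt0 ?oppr_gt0 // cb.
exists (\big[Num.min/1]_i w i).
  by elim/big_ind: _ => // x y x0 y0; rewrite lt_min x0.
move=> i; rewrite !mxE.
have : \big[Num.min/1]_i w i <= w i by apply: bigmin_le_cond.
have : 0 < \big[Num.min/1]_i w i.
  by elim/big_ind: _ => // x y x0 y0; rewrite lt_min x0.
move: (\big[_/_]_i _) => e e0; rewrite /w; case: ltP => [h|h _].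
  by rewrite ler_pdivlMr ?oppr_gt0 // mulrN -subr_ge0 opprK.
by rewrite addr_ge0 // mulr_ge0 // ltW.
Qed.

(** The ratio test of the simplex method: the step is the least [b i / - c i] over the decreasing
    coordinates, and a minimising coordinate becomes zero. *)
Lemma exists_maximal_step b c : nonneg b ->
  (forall i, c 0 i != 0 -> 0 < b 0 i) -> (exists i, c 0 i < 0) ->
  exists2 e : R, 0 < e &
    nonneg (b + e *: c) /\ supp (b + e *: c) \proper supp b.
Proof.
move=> b0 cb [i0 ci0].
have [i ci imin] := @Order.TotalTheory.arg_minP _ R 'I_N i0
  (fun i => c 0 i < 0) (fun i => b 0 i / - c 0 i) ci0.
have bi : 0 < b 0 i by apply: cb; rewrite lt_eqF.
have e0 : 0 < b 0 i / - c 0 i by rewrite divr_gt0 // oppr_gt0.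
exists (b 0 i / - c 0 i) => //; split.
  move=> j; rewrite !mxE; have [h|h] := ltP (c 0 j) 0.
    have := imin _ h; rewrite ler_pdivlMr ?oppr_gt0 // mulrN => h2.
    by rewrite -subr_ge0 opprK in h2.
  by rewrite addr_ge0 // mulr_ge0 // ltW.
apply/properP; split.
  apply/fintype.subsetP => j; rewrite !inE !mxE; apply: contraNN => /eqP bj.
  have [->|/cb] := eqVneq (c 0 j) 0; first by rewrite mulr0 bj addr0.
  by rewrite bj ltxx.
exists i; first by rewrite inE gt_eqF.
by rewrite !inE negbK !mxE invrN mulrN mulNr divfK ?subrr // lt_eqF.
Qed.

Lemma sum0_has_neg c : \sum_i c 0 i = 0 -> c != 0 -> exists i, c 0 i < 0.
Proof.
move=> s; apply: contra_neqP => H.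
apply/rowP => i; rewrite mxE.
have c0 j : true -> 0 <= c 0 j.
  by move=> _; rewrite leNgt; apply/negP => h; apply: H; exists j.
by move/eqP: s; rewrite psumr_eq0 // => /allP/(_ i (mem_index_enum _))/eqP.
Qed.

(** Affine independence of the rows of [U] indexed by [S]. *)
Definition independent S : Prop :=
  forall c, dependency c -> supp c \subset S -> c = 0.

Definition represents b b' : Prop :=
  [/\ nonneg b', b' *m U = b *m U & \sum_i b' 0 i = \sum_i b 0 i].

Lemma representsD b c : dependency c -> nonneg (b + c) -> represents b (b + c).
Proof.
move=> [cU c0] h; split=> //; first by rewrite mulmxDl cU addr0.
under eq_bigr do rewrite mxE.
by rewrite big_split /= c0 addr0.
Qed.

Lemma represents_trans b b' b'' :
  represents b b' -> represents b' b'' -> represents b b''.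
Proof. by move=> [_ u s] [? u' s']; split; rewrite ?u' ?s'. Qed.

Lemma nonneg_supp b i : nonneg b -> (0 < b 0 i) = (i \in supp b).
Proof. by move=> b0; rewrite inE lt_def b0 andbT. Qed.

(** Carathéodory's reduction: moving along a dependency until a coordinate vanishes shrinks the
    support. Each dependency is first given the sign that makes it lexicographically positive, so
    every move goes upwards. *)
Lemma represents_independent b : nonneg b -> exists b',
  [/\ represents b b', independent (supp b') & b' = b \/ lexpos (b' - b)].
Proof.
have [k] := ubnP #|supp b|; elim: k b => // k IH b bk b0.
have [iS|] := pselect (independent (supp b)).
  by exists b; split=> //; left.
move=> /existsNP[c /not_implyP[cD /not_implyP[cS /eqP c0]]].
wlog cpos : c cD cS c0 / lexpos c.
  move=> W; case: (lexpos_trichotomy c) => [/eqP|/W|h].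
  - by rewrite (negPf c0).
  - exact.
  apply: (W (- c)) => //; last by rewrite oppr_eq0.
    by rewrite -scaleN1r; apply: dependencyZ.
  apply: fintype.subset_trans cS; apply/fintype.subsetP => i.
  by rewrite !inE mxE oppr_eq0.
have [|e e0 [pos lt]] := @exists_maximal_step b c b0 _ (sum0_has_neg cD.2 c0).
  by move=> i ci; rewrite nonneg_supp // (fintype.subsetP cS) // inE.
have [//|b' [r iS' l]] := IH (b + e *: c) _ pos.
  by rewrite (leq_trans (proper_card lt)).
exists b'; split=> //.
  by apply: represents_trans r; apply: representsD => //; apply: dependencyZ.
right; have p : lexpos (e *: c) by apply: lexposZ.
case: l => [->|l]; first by rewrite addrC addKr.
have -> : b' - b = b' - (b + e *: c) + e *: c by rewrite opprD addrA subrK.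
exact: lexposD.
Qed.

Lemma exists_lexmax (s : seq 'rV[R]_N) : s != [::] ->
  exists2 b, b \in s & forall b', b' \in s -> ~ lexpos (b' - b).
Proof.
elim: s => // a [_ _|a' s IH _].
  by exists a; rewrite ?mem_head // => b'; rewrite inE => /eqP ->;
    rewrite subrr; apply: lexpos0.
have {IH}[//|b bs bmax] := IH _.
have [h|h] := pselect (lexpos (a - b)).
  exists a; rewrite ?mem_head // => b'; rewrite inE => /predU1P[->|/bmax b'b l].
    by rewrite subrr; apply: lexpos0.
  by apply: b'b; rewrite -(subrK a b') -addrA; apply: lexposD.
exists b; first by rewrite inE bs orbT.
by move=> b'; rewrite inE => /predU1P[->|/bmax].
Qed.

(* The lexicographically largest representation; it suffices to maximise over
   the finitely many independent supports, as [represents_independent] never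
   moves lexicographically downwards. *)
Lemma exists_admissible b : nonneg b ->
  exists b', represents b b' /\ admissible (supp b').
Proof.
move=> b0.
pose Q b' := represents b b' /\ independent (supp b').
(* There is at most one representation per independent support, since two of them differ by a
   dependency on that support; so [s] lists them all. *)
pose g (S : {set 'I_N}) := xget 0 [set b' | Q b' /\ supp b' = S]%classic.
pose s := [seq b' <- [seq g A | A : {set 'I_N}] | `[< Q b' >]].
have sP b' : b' \in s <-> Q b'.
  rewrite mem_filter; split=> [/andP[/asboolP]//|Qb'].
  apply/andP; split; first exact/asboolP.
  apply/mapP; exists (supp b'); rewrite ?mem_enum //.
  rewrite /g; case: xgetP => [y _ [[ry iy] sy]|/(_ b')]; last by case.
  apply/eqP; rewrite -subr_eq0; apply/eqP; apply: Qb'.2.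
    case: ry Qb'.1 => _ yU ys [_ b'U b's].
    by apply: dependencyB; rewrite ?b'U ?b's.
  apply/fintype.subsetP => i; apply: contraTT => iS; move: (iS); rewrite -sy.
  by move: iS; rewrite !inE !negbK !mxE => /eqP -> /eqP ->; rewrite subr0.
have s0 : s != [::].
  have [b1 [r1 i1 _]] := represents_independent b0.
  have /sP : Q b1 by [].
  by case: s {sP}.
have [b' /sP[rb' ib'] bmax] := exists_lexmax s0.
(* A violating [c] would allow a small step upwards from [b']; reducing the result to an independent
   support yields a member of [s] above the maximum. *)
exists b'; split=> // c cD cS cpos.
have [||e e0 pos] := @exists_small_step b' c.
- by case: rb'.
- move=> i ci; rewrite nonneg_supp; last by case: rb'.
  by apply: contraTT ci => /cS; rewrite -leNgt.
have [b2 [r2 i2 l2]] := represents_independent pos.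
have p : lexpos (e *: c) by apply: lexposZ.
apply: (bmax b2).
  apply/sP; split=> //; apply: represents_trans rb' _.
  by apply: represents_trans r2; apply: representsD => //; apply: dependencyZ.
case: l2 => [->|l]; first by rewrite addrC addKr.
have -> : b2 - b' = b2 - (b' + e *: c) + e *: c by rewrite opprD addrA subrK.
exact: lexposD.
Qed.

End LexTriangulation.

(** * Newton expansions with natural coefficients *)

Section Newton.

(** Since ['C(k, j)] vanishes for [j > k], stopping the sum at [k] avoids any degree bound on
    [f]. *)
Definition newton_nat (F : nat -> nat) : Prop :=
  exists f : nat -> nat, forall k, F k = (\sum_(j < k.+1) f j * 'C(k, j))%N.

Lemma newton_nat_sum (I : Type) (r : seq I) (F : I -> nat -> nat) :
  (forall i, newton_nat (F i)) -> newton_nat (fun k => \sum_(i <- r) F i k)%N.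
Proof.
move=> /choice[f fP]; exists (fun j => \sum_(i <- r) f i j)%N => k.
under eq_bigr do rewrite fP.
by rewrite exchange_big; apply: eq_bigr => j _; rewrite big_distrl.
Qed.

(** Iterating Pascal's rule [a] times gives Vandermonde's expansion with natural coefficients. *)
Lemma newton_nat_bin a c : newton_nat (fun k => 'C(k + a, c)).
Proof.
elim: a c => [|a IH] [|c].
- exists (fun j => (j == 0)%N : nat) => k.
  by rewrite big_ord_recl !bin0 big1.
- exists (fun j => (j == c.+1) : nat) => k; rewrite addn0.
  have [ck|kc] := ltnP c.+1 k.+1.
    rewrite (bigD1 (Ordinal ck)) //= eqxx mul1n big1 ?addn0 // => i.
    by rewrite -val_eqE /= => /negPf ->.
  rewrite bin_small // big1 // => i _; rewrite ltn_eqF ?mul0n //.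
  exact: leq_trans (ltn_ord i) kc.
- exists (fun j => (j == 0)%N : nat) => k.
  by rewrite big_ord_recl !bin0 big1.
- have [f fP] := IH c.+1; have [g gP] := IH c.
  exists (fun j => f j + g j)%N => k.
  rewrite addnS binS fP gP -big_split /=.
  by apply: eq_bigr => j _; rewrite mulnDl.
Qed.

Lemma gbinom_nat (R : realType) (k i : nat) : gbinom (k%:R : R) i = 'C(k, i)%:R.
Proof.
rewrite /gbinom.
have f0 : i`!%:R != 0 :> R by rewrite pnatr_eq0 -lt0n fact_gt0.
have [ik|ki] := leqP i k; last first.
  by rewrite bin_small // (bigD1 (Ordinal ki)) //= subrr !mul0r.
apply: (mulIf f0); rewrite divfK // -natrM bin_ffact ffact_prod natr_prod.
apply: eq_bigr => j _; rewrite natrB // ltnW //.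
exact: leq_trans (ltn_ord j) ik.
Qed.

(** At [i.+1] both expansions are combinations of the ['C(i, j)] with [j <= i], and the coefficient
    of index [i] is multiplied by 1. This unitriangular system identifies the coefficients by strong
    induction. *)
Lemma fstar_nat (R : realType) (q : {poly R}) (d : nat) (F : nat -> nat) :
  (size q <= d.+1)%N -> newton_nat F ->
  (forall k, q.[k.+1%:R] = (F k)%:R) ->
  forall i, fstar q d ord0 i \is a Num.nat.
Proof.
move=> qd [f Ff] qF.
have fs : is_fstar q (fstar q d).
  have [g gP] := is_fstar_exists qd.
  by rewrite /fstar; case: xgetP => // /(_ g).
suff E i : fstar q d ord0 i = (f i)%:R by move=> i; rewrite E natr_nat.
have [k] := ubnP i; elim: k i => // k IH i ik.
have := fs i.+1%:R; rewrite qF Ff -natr1 addrK.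
rewrite (big_ord_widen d.+1 (fun j => f j * 'C(i, j))%N) // big_mkcond /=.
rewrite natr_sum (bigD1 i) //= [RHS](bigD1 i) //= ltnSn binn muln1.
rewrite [X in _ + X = _](eq_bigr (fun j : 'I_d.+1 =>
  fstar q d ord0 j * gbinom i%:R j)) => [|j ji]; last first.
  rewrite gbinom_nat; case: ltnP => [ji'|ij]; last by rewrite bin_small ?mulr0.
  rewrite natrM IH // -ltnS (leq_trans _ ik) // ltnS ltn_neqAle ji.
  exact: ji'.
by rewrite gbinom_nat binn mulr1 => /addIr.
Qed.

End Newton.

(** * Weak compositions, listed as row vectors with prescribed support and sum *)

Section Compositions.
Variables (R : realType) (N : nat).
Implicit Types (S : {set 'I_N}) (s : nat).

(** Stars and bars; bounding the parts by [s] loses nothing, as they add up to [s]. *)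
Lemma card_compositions e s : (0 < e)%N ->
  #|[set t : e.-tuple 'I_s.+1 | (\sum_(i <- t) i)%N == s]| = 'C(e.-1 + s, e.-1).
Proof. by case: e => // e _; rewrite card_ord_partitions. Qed.

(* [index i (enum S)] is out of range when [i \notin S], whence the entry 0. *)
Definition composition_row S s (t : #|S|.-tuple 'I_s.+1) : 'rV[R]_N :=
  \row_i (nth ord0 t (index i (enum S)))%:R.

Definition compositions S s : seq 'rV[R]_N :=
  [seq composition_row t |
     t <- enum [set t : #|S|.-tuple 'I_s.+1 | (\sum_(i <- t) i)%N == s]].

Lemma size_compositions S s : (0 < #|S|)%N ->
  size (compositions S s) = 'C(#|S|.-1 + s, #|S|.-1).
Proof. by move=> S0; rewrite size_map -cardE card_compositions. Qed.

Lemma composition_row_inj S s : injective (@composition_row S s).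
Proof.
move=> t u /rowP tu; apply: eq_from_tnth => j.
pose i0 := enum_val j.
have := tu (nth i0 (enum S) j); rewrite !mxE index_uniq ?enum_uniq -?cardE //.
by rewrite !(tnth_nth ord0) => /eqP; rewrite eqr_nat => /eqP/val_inj.
Qed.

Lemma uniq_compositions S s : uniq (compositions S s).
Proof. by rewrite map_inj_uniq ?enum_uniq //; apply: composition_row_inj. Qed.

Lemma sum_composition_row S s (t : #|S|.-tuple 'I_s.+1) :
  \sum_i composition_row t 0 i = (\sum_(i <- t) i)%N%:R.
Proof.
rewrite (bigID (mem S)) /= [X in _ + X]big1 => [|i iS]; last first.
  rewrite mxE nth_default // memNindex ?mem_enum // size_tuple cardE //.
rewrite addr0 -big_enum /= natr_sum.
under eq_bigr do rewrite mxE.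
case: (pickP (mem S)) => [i0 _|S0].
  rewrite (big_nth i0) [RHS](big_nth ord0) size_tuple -cardE.
  apply: eq_big_nat => j /andP[_ jS].
  by rewrite index_uniq ?enum_uniq -?cardE.
have t0 : tval t = [::] by apply: size0nil; rewrite size_tuple (eq_card0 S0).
by rewrite (eq_enum S0) enum0 big_nil t0 big_nil.
Qed.

Lemma mem_compositions S s r : r \in compositions S s <->
  [/\ forall i, r 0 i \is a Num.nat, supp r \subset S & \sum_i r 0 i = s%:R].
Proof.
split=> [/mapP[t]|[rN rS rs]].
  rewrite mem_enum inE => /eqP ts ->; split=> [i||].
  - by rewrite mxE natr_nat.
  - apply/fintype.subsetP => i; rewrite inE mxE; apply: contraNT => iS.
    by rewrite nth_default // memNindex ?mem_enum // size_tuple cardE.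
  - by rewrite sum_composition_row ts.
pose a i := Num.truncn (r 0 i).
have aE i : (a i)%:R = r 0 i by rewrite truncnK.
have as_ : (\sum_i a i = s)%N.
  apply/eqP; rewrite -(eqr_nat R) natr_sum -rs; apply/eqP.
  by apply: eq_bigr => i _; rewrite aE.
have als i : (a i < s.+1)%N by rewrite ltnS -as_ (bigD1 i) //= leq_addr.
have tP : size [seq inord (a i) : 'I_s.+1 | i <- enum S] == #|S|.
  by rewrite size_map cardE.
have rE : r = composition_row (Tuple tP).
  apply/rowP => i; rewrite mxE /=; have [iS|iS] := boolP (i \in S).
    rewrite (nth_map i) ?index_mem ?mem_enum // nth_index ?mem_enum //.
    by rewrite inordK // aE.
  rewrite nth_default; last by rewrite size_map leqNgt index_mem mem_enum.
  by apply/eqP; apply: contraNT iS => ri; rewrite (fintype.subsetP rS) // inE.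
apply/mapP; exists (Tuple tP) => //.
by rewrite mem_enum inE -(eqr_nat R) -sum_composition_row -rE rs.
Qed.

End Compositions.

(** * Lattice points of simplicial cones by means of fundamental parallelepipeds *)

Lemma seq_of_finite_inj (T : choiceType) (F : finType) (x0 : T) (M : set T)
    (phi : T -> F) :
  (forall x y, M x -> M y -> phi x = phi y -> x = y) ->
  exists s : seq T, uniq s /\ forall x, x \in s <-> M x.
Proof.
move=> inj; pose g z := xget x0 [set x | M x /\ phi x = z]%classic.
exists (undup [seq x <- [seq g z | z : F] | `[< M x >]]).
split=> [|x]; first exact: undup_uniq.
rewrite mem_undup mem_filter; split=> [/andP[/asboolP]//|Mx].
apply/andP; split; first exact/asboolP.
apply/mapP; exists (phi x); rewrite ?mem_enum // /g.
by case: xgetP => [y _ [My yx]|/(_ x)[]//]; apply/inj.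
Qed.

(** Subtracting the ceiling minus one, rather than the floor, leaves a remainder that is still
    positive, so supports survive the reduction to a parallelepiped. *)
Lemma pos_ceil_decomp (R : realType) (y : R) : 0 < y ->
  exists a : nat, 0 < y - a%:R <= 1.
Proof.
move=> y0; have c0 : 0 < Num.ceil y by rewrite ceil_gt0.
exists `|Num.ceil y - 1|%N.
rewrite natr_absz ger0_norm ?subr_ge0 ?gtz0_ge1 // intrB.
have := ceil_itv y; move=> /andP[]; rewrite intrB; lra.
Qed.

Section Count.
Variables (R : realType) (N n m l : nat) (U : 'M[R]_(N, n)).
(** [G] abstracts a union of disjoint open simplicial cones: among nonnegative vectors membership
    depends only on the support, and a point with its height determines the coefficients. *)
Variable G : set 'rV[R]_N.
Hypothesis m_gt0 : (0 < m)%N.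
Hypothesis lm : (l < m)%N.
Hypothesis U_int : forall i j, U i j \is a Num.int.
Hypothesis G_nonneg : forall b, G b -> nonneg b.
Hypothesis G_sum_gt0 : forall b, G b -> 0 < \sum_i b 0 i.
Hypothesis G_supp : forall b b',
  G b -> nonneg b' -> supp b' = supp b -> G b'.
Hypothesis G_inj : forall b b', G b -> G b' ->
  b *m U = b' *m U -> \sum_i b 0 i = \sum_i b' 0 i -> b = b'.

(* The lattice points of the half-open fundamental parallelepipeds with
   coefficients in (0, 1], restricted to heights congruent to l modulo m. *)
Let fundamental : set 'rV[R]_N := [set b | [/\ G b, forall i, b 0 i <= 1,
  integer_points (b *m U) &
  exists h : nat, m%:R * (\sum_i b 0 i) = (h * m + l)%N%:R]]%classic.

Let height (b : 'rV[R]_N) : nat :=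
  xget 0%N [set h | m%:R * (\sum_i b 0 i) = (h * m + l)%N%:R :> R]%classic.

Let heightP b : fundamental b ->
  m%:R * (\sum_i b 0 i) = (height b * m + l)%N%:R :> R.
Proof.
move=> [_ _ _ [h hP]]; rewrite /height.
by case: xgetP => // /(_ h).
Qed.

Let fundamental_card_gt0 b : fundamental b -> (0 < #|supp b|)%N.
Proof.
move=> [/G_sum_gt0 s _ _ _]; rewrite card_gt0; apply/negP => /eqP b0.
move: s; rewrite big1 ?ltxx // => i _; apply/eqP.
by have := finset.in_set0 i; rewrite -b0 inE => /negbFE.
Qed.

(** Coefficients at most 1 bound [h * m + l] by [m * #|supp b|]. Hence the subtraction
    [#|supp b| - height b] used in the count below is not truncated. *)
Let height_le b : fundamental b -> (height b <= #|supp b|)%N.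
Proof.
move=> fb; have hb := heightP fb; case: fb => _ b1 _ _.
have sb : \sum_i b 0 i <= #|supp b|%:R.
  rewrite (bigID (mem (supp b))) /= [X in _ + X]big1 => [|i]; last first.
    by rewrite inE negbK => /eqP.
  rewrite addr0 -sum1_card natr_sum; exact: ler_sum.
have m0 : 0 < m%:R :> R by rewrite ltr0n.
rewrite -(leq_pmul2l m_gt0) -(ler_nat R) [in X in _ <= X]natrM.
apply: (@le_trans _ _ (m%:R * \sum_i b 0 i)); last by rewrite ler_pM2l.
by rewrite hb ler_nat mulnC leq_addr.
Qed.

Let finite_fundamental :
  exists s : seq 'rV[R]_N, uniq s /\ forall b, b \in s <-> fundamental b.
Proof.
(* [C] bounds the coordinates of [b *m U] when the coefficients are in [0, 1]. Shifted by [C], they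
   become bounded naturals, and [phi] records them with the scaled height; [G_inj] makes [phi]
   injective. *)
pose C := (Num.truncn (\sum_i \sum_j `|U i j|)).+1.
have CP : \sum_i \sum_j `|U i j| <= C%:R.
  exact/ltW/truncnS_gt.
pose a (b : 'rV[R]_N) j := Num.truncn ((b *m U) 0 j + C%:R).
pose c (b : 'rV[R]_N) := Num.truncn (m%:R * \sum_i b 0 i).
pose phi b : {ffun 'I_n -> 'I_(C + C).+1} * 'I_(m * N).+1 :=
  ([ffun j => inord (a b j)], inord (c b)).
have bU b j : fundamental b -> `|(b *m U) 0 j| <= C%:R.
  move=> [/G_nonneg b0 b1 _ _]; apply: le_trans CP.
  rewrite mxE (le_trans (ler_norm_sum _ _ _)) //; apply: ler_sum => i _.
  rewrite normrM (@le_trans _ _ `|U i j|) //.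
    by rewrite ler_piMl // ger0_norm.
  by rewrite (bigD1 j) //= lerDl sumr_ge0.
have aE b j : fundamental b -> (a b j)%:R = (b *m U) 0 j + C%:R.
  move=> fb; rewrite truncnK // natrEint; have := bU _ j fb.
  rewrite ler_norml => /andP[lo _]; rewrite -lerBlDr sub0r lo andbT.
  by rewrite rpredD ?natr_int //; case: fb => _ _ /(_ j).
have cE b : fundamental b -> (c b)%:R = m%:R * \sum_i b 0 i.
  by move=> /heightP h; rewrite truncnK // h natr_nat.
have al b j : fundamental b -> (a b j < (C + C).+1)%N.
  move=> fb; rewrite ltnS -(ler_nat R) aE // natrD lerD2r.
  by have := bU _ j fb; rewrite ler_norml => /andP[].
have cl b : fundamental b -> (c b < (m * N).+1)%N.
  move=> fb; rewrite ltnS -(ler_nat R) cE // natrM ler_pM2l ?ltr0n //.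
  case: fb => _ b1 _ _.
  by rewrite (le_trans (ler_sum _ (fun i _ => b1 i))) // sumr_const card_ord.
apply: (@seq_of_finite_inj _ _ 0 _ phi) => x y fx fy [] /ffunP e1 e2.
apply: G_inj; [by case: fx|by case: fy| |].
  apply/rowP => j; have := e1 j; rewrite !ffunE => /(congr1 val) /=.
  rewrite !inordK ?al // => /(congr1 (fun k => k%:R : R)).
  by rewrite !aE // => /addIr.
have := congr1 val e2; rewrite /= !inordK ?cl //.
move=> /(congr1 (fun k => k%:R : R)); rewrite !cE // => /mulfI -> //.
by rewrite pnatr_eq0 -lt0n.
Qed.

Lemma points_of_height_newton : exists F : nat -> nat, newton_nat F /\
  forall k, exists s : seq 'rV[R]_n, [/\ uniq s, size s = F k &
    forall x, x \in s <-> integer_points x /\ exists b, [/\ G b, b *m U = x &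
      m%:R * (\sum_i b 0 i) = (k.+1 * m + l)%N%:R]].
Proof.
have [Ms [Mu MP]] := finite_fundamental.
have m0 : m%:R != 0 :> R by rewrite pnatr_eq0 -lt0n.
(* With [e = #|supp b|] and [h = height b], this counts the ways to distribute [k.+1 - h] units over
   [e] generators, as [e.-1 + (k.+1 - h) = k + (e - h)]. For [h > k.+1] the upper index is below
   [e.-1] and the binomial is 0. *)
exists (fun k => \sum_(b <- Ms) 'C(k + (#|supp b| - height b), #|supp b|.-1))%N.
split; first by apply: newton_nat_sum => b; apply: newton_nat_bin.
move=> k.
pose L (b : 'rV[R]_N) : seq 'rV[R]_N := if (height b <= k.+1)%N
  then compositions R (supp b) (k.+1 - height b) else [::].
have LP b r : r \in L b <-> [/\ forall i, r 0 i \is a Num.nat,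
    supp r \subset supp b & (height b)%:R + \sum_i r 0 i = k.+1%:R].
  rewrite /L; case: leqP => hk.
    rewrite mem_compositions natrB //; split=> -[? ? h]; split=> //.
      by rewrite h addrC subrK.
    by rewrite -h addrC addKr.
  split=> // -[rN _ h]; move: hk.
  rewrite -(ltr_nat R) -h gtrDl ltNge sumr_ge0 //.
  by move=> i _; apply: natr_ge0.
have GD b r : fundamental b -> r \in L b -> G (b + r) /\
    m%:R * (\sum_i (b + r) 0 i) = (k.+1 * m + l)%N%:R.
  move=> fb /LP[rN rS rh]; have hb := heightP fb; case: fb => Gb _ _ _.
  have b0 := G_nonneg Gb; have r0 i := natr_ge0 (rN i).
  split.
    apply: G_supp Gb _ _; first by move=> i; rewrite mxE addr_ge0.
    apply/setP => i; rewrite !inE mxE paddr_eq0 //.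
    apply/idP/idP; last by apply: contraNN => /andP[].
    apply: contraNN => bi; rewrite bi /= -[_ == _]negbK; apply/negP => ri.
    by have := fintype.subsetP rS i; rewrite !inE ri bi => /(_ isT).
  under eq_bigr do rewrite mxE.
  rewrite big_split /= mulrDr hb.
  rewrite [(k.+1 * m + l)%N%:R]natrD [(k.+1 * m)%N%:R]natrM -rh natrD natrM.
  lra.
exists [seq (b + r) *m U | b <- Ms, r <- L b]; split.
- apply: allpairs_uniq_dep => //.
    by move=> b _; rewrite /L; case: ifP => // _; apply: uniq_compositions.
  move=> [b r] [b' r'] /allpairsPdep[x [y [/MP fx yL [-> ->]]]].
  move=> /allpairsPdep[x' [y' [/MP fx' yL' [-> ->]]]] /= E.
  have [G1 h1] := GD _ _ fx yL; have [G2 h2] := GD _ _ fx' yL'.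
  have {h1 h2}E : x + y = x' + y'.
    by apply: G_inj => //; apply: (mulfI m0); rewrite h1.
  (* Where a coordinate of [x] or [x'] is 0, so is the added natural number. Elsewhere both lie in
     (0, 1], so the natural parts differ by less than 1 and agree. *)
  suff e : x = x' by move: E; rewrite e => /addrI ->.
  move: yL yL' => /LP[yN yS _] /LP[yN' yS' _].
  apply/rowP => i; have /rowP/(_ i) := E; rewrite !mxE.
  case: fx fx' => Gx x1 _ _ [Gx' x1' _ _].
  have := G_nonneg Gx i; have := G_nonneg Gx' i; have := x1 i; have := x1' i.
  have zy : x 0 i = 0 -> y 0 i = 0.
    move=> xi; apply/eqP; rewrite -[_ == _]negbK; apply/negP => yi.
    by have := fintype.subsetP yS i; rewrite !inE yi xi eqxx => /(_ isT).
  have zy' : x' 0 i = 0 -> y' 0 i = 0.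
    move=> xi; apply/eqP; rewrite -[_ == _]negbK; apply/negP => yi.
    by have := fintype.subsetP yS' i; rewrite !inE yi xi eqxx => /(_ isT).
  move/natrP: (yN i) zy => [a ->]; move/natrP: (yN' i) zy' => [a' ->].
  move=> zy' zy xi1' xi1 xi0' xi0 e.
  have [xz|xz] := eqVneq (x 0 i) 0.
    move: e; rewrite xz (zy xz) addr0 => /esym/eqP.
    by rewrite paddr_eq0 // => /andP[/eqP ->].
  have [xz'|xz'] := eqVneq (x' 0 i) 0.
    move: e; rewrite xz' (zy' xz') addr0 => /eqP.
    by rewrite paddr_eq0 // => /andP[/eqP ->].
  have xp : 0 < x 0 i by rewrite lt_def xz.
  have xp' : 0 < x' 0 i by rewrite lt_def xz'.
  suff aa : a = a' by move: e; rewrite aa => /addIr.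
  by apply/eqP; rewrite eqn_leq; apply/andP; split;
    rewrite -ltnS -(ltr_nat R) -natr1; lra.
- rewrite size_allpairs_dep sumnE big_map; apply: eq_big_seq => b /MP fb.
  have e0 := fundamental_card_gt0 fb; have he := height_le fb.
  rewrite /L; case: leqP => hk; last first.
    rewrite bin_small //; move: #|_| (height b) e0 he hk => e h; lia.
  rewrite size_compositions //; congr 'C(_, _).
  move: #|_| (height b) e0 he hk => e h; lia.
- move=> x; split.
    move=> /allpairsPdep[b [r [/MP fb rL ->]]].
    have [Gbr h] := GD _ _ fb rL; split; last by exists (b + r).
    move: rL => /LP[rN _ _] j; rewrite mulmxDl mxE rpredD //.
      by case: fb => _ _ /(_ j).
    by rewrite mxE rpred_sum // => i _; rewrite rpredM // intr_nat.
  move=> [xI [b [Gb bU hb]]].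
  have b0 := G_nonneg Gb.
  (* Off the support [a] must be 0, lest the reduced coefficient become negative. *)
  have /choice[a aP] i : exists a : nat,
      if b 0 i == 0 then a = 0%N else 0 < b 0 i - a%:R <= 1.
    case: eqVneq => [_|bi]; first by exists 0%N.
    by apply: pos_ceil_decomp; rewrite lt_def bi b0.
  pose r : 'rV[R]_N := \row_i (a i)%:R.
  have mu0 : nonneg (b - r).
    move=> i; rewrite !mxE; have := aP i.
    by case: eqVneq => [-> ->|_ /andP[/ltW]//]; rewrite subr0.
  have mus : supp (b - r) = supp b.
    apply/setP => i; rewrite !inE !mxE; have := aP i.
    case: eqVneq => [-> ->|_ /andP[h _]]; first by rewrite subr0 eqxx.
    by rewrite gt_eqF.
  have sumE : m%:R * (\sum_i (b - r) 0 i) =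
      (k.+1%:R - \sum_i (a i)%:R) * m%:R + l%:R :> R.
    under eq_bigr do rewrite !mxE.
    rewrite big_split /= sumrN mulrDr hb natrD natrM; lra.
  have fmu : fundamental (b - r).
    split.
    - exact: G_supp Gb _ _.
    - move=> i; rewrite !mxE; have := aP i.
      by case: eqVneq => [-> ->|_ /andP[]//]; rewrite subr0.
    - move=> j; rewrite mulmxBl bU !mxE rpredB // rpred_sum // => i _.
      by rewrite mxE rpredM // natr_int.
    (* Nonnegativity of the reduced sum gives a bound by [k.+1 * m + l]; since [l < m], dividing by
       [m] leaves [k.+1]. *)
    - have ak : (\sum_i a i <= k.+1)%N.
        have : 0 <= m%:R * (\sum_i (b - r) 0 i).
          by rewrite mulr_ge0 // sumr_ge0.
        rewrite sumE -natr_sum => h.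
        have : ((\sum_i a i) * m <= k.+1 * m + l)%N.
          rewrite -(ler_nat R) natrD !natrM; lra.
        by nia.
      exists (k.+1 - \sum_i a i)%N.
      by rewrite sumE natrD natrM natrB // natr_sum.
  apply/allpairsPdep; exists (b - r), r; split.
  - exact/MP.
  - apply/LP; split.
    + by move=> i; rewrite mxE natr_nat.
    + rewrite mus; apply/fintype.subsetP => i; rewrite !inE mxE.
      by have := aP i; case: eqVneq => // _ ->; rewrite eqxx.
    + have := heightP fmu; rewrite sumE natrD natrM => /addIr.
      move=> /(mulIf m0) <-.
      by under [X in _ + X]eq_bigr do rewrite mxE; rewrite subrK.
  - by rewrite subrK bU.
Qed.

End Count.

(** * Convex hulls of matrix rows, vertices and relative interiors *)

Section MatrixHull.
Local Open Scope classical_set_scope.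
Variables (R : realType) (n : nat).

Definition mconv N (V : 'M[R]_(N, n)) : set 'rV[R]_n :=
  [set x | exists a : 'rV[R]_N, [/\ nonneg a, \sum_i a 0 i = 1 & x = a *m V]].

Lemma mconv_row N (V : 'M[R]_(N, n)) i : mconv V (row i V).
Proof.
exists (delta_mx 0 i); split; last by rewrite rowE.
  by move=> j; rewrite mxE ler0n.
rewrite (bigD1 i) //= mxE !eqxx big1 ?addr0 // => j ji.
by rewrite mxE (negPf ji) andbF.
Qed.

Lemma mconv_sub N N' (V : 'M[R]_(N, n)) (W : 'M[R]_(N', n)) :
  (forall i, mconv V (row i W)) -> mconv W `<=` mconv V.
Proof.
move=> /choice[B BP] x [a [a0 a1 ->]].
exists (a *m \matrix_i B i); split.
- move=> j; rewrite mxE sumr_ge0 // => i _; rewrite mxE mulr_ge0 //.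
  by case: (BP i).
- under eq_bigr do rewrite mxE.
  rewrite exchange_big -[RHS]a1; apply: eq_bigr => i _.
  rewrite -mulr_sumr; under eq_bigr do rewrite mxE.
  by case: (BP i) => _ -> _; rewrite mulr1.
- rewrite -mulmxA; congr mulmx; apply/row_matrixP => i.
  by rewrite row_mul rowK; case: (BP i).
Qed.

Lemma mconv_convex N (V : 'M[R]_(N, n)) x y (t : R) : 0 <= t <= 1 ->
  mconv V x -> mconv V y -> mconv V (t *: x + (1 - t) *: y).
Proof.
move=> /andP[t0 t1] [a [a0 a1 ->]] [b [b0 b1 ->]].
exists (t *: a + (1 - t) *: b); split.
- by move=> i; rewrite !mxE addr_ge0 // mulr_ge0 // subr_ge0.
- under eq_bigr do rewrite !mxE.
  by rewrite big_split -!mulr_sumr /= a1 b1 !mulr1 addrC subrK.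
- by rewrite mulmxDl !scalemxAl.
Qed.

Lemma convex_hull_mconv (s : seq 'rV[R]_n) :
  convex_hull [set` s] = mconv (\matrix_(i < size s) s`_i).
Proof.
apply/seteqP; split=> x.
  move=> [M [v [a [vs a0 a1 ->]]]].
  have /choice[p pP] i : exists j : 'I_(size s), s`_j = v i.
    have vi : (index (v i) s < size s)%N by rewrite index_mem; apply: vs.
    by exists (Ordinal vi); rewrite /= nth_index //; apply: vs.
  exists (\row_j \sum_(i | p i == j) a i); split.
  - by move=> j; rewrite mxE sumr_ge0.
  - under eq_bigr do rewrite mxE.
    by rewrite -[RHS]a1 (partition_big p xpredT).
  - rewrite mulmx_sum_row (partition_big p xpredT) //=.
    apply: eq_bigr => j _; rewrite mxE rowK scaler_suml.
    by apply: eq_bigr => i /eqP <-; rewrite pP.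
move=> [a [a0 a1 ->]].
exists (size s), (fun i => s`_i), (fun i => a 0 i); split=> //.
  by move=> i /=; apply: mem_nth.
by rewrite mulmx_sum_row; apply: eq_bigr => i _; rewrite rowK.
Qed.

(** A proper segment through the row writes it as [c *m V]. If [c] had entry 1 at [i0], both ends
    would equal the row; so the term at [i0] can be moved across and divided out. *)
Lemma nonvertex_row N (V : 'M[R]_(N.+1, n)) i0 :
  ~ vertices (mconv V) (row i0 V) -> mconv (row' i0 V) (row i0 V).
Proof.
move=> /not_andP[|]; first by case; apply: mconv_row.
move=> /existsNP[y /existsNP[z /existsNP[t]]].
move=> /not_implyP[[a [a0 a1 ->]] /not_implyP[[b [b0 b1 ->]]]].
move=> /not_implyP[/andP[t0 t1] /not_implyP[vE nE]].
pose c := t *: a + (1 - t) *: b.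
have cE i : c 0 i = t * a 0 i + (1 - t) * b 0 i by rewrite !mxE.
have c0 i : 0 <= c 0 i by rewrite cE addr_ge0 // mulr_ge0 // ?subr_ge0 // ltW.
have c1 : \sum_i c 0 i = 1.
  under eq_bigr do rewrite cE.
  by rewrite big_split -!mulr_sumr /= a1 b1 !mulr1 addrC subrK.
have vc : row i0 V = c *m V by rewrite mulmxDl -!scalemxAl.
clearbody c.
have sumD (d : 'rV[R]_N.+1) : \sum_i d 0 i = d 0 i0 + \sum_j d 0 (lift i0 j).
  exact: bigD1_ord.
have mulD (d : 'rV[R]_N.+1) :
    d *m V = d 0 i0 *: row i0 V + \sum_j d 0 (lift i0 j) *: row (lift i0 j) V.
  by rewrite mulmx_sum_row; apply: bigD1_ord.
have only (d : 'rV[R]_N.+1) : (forall i, 0 <= d 0 i) -> \sum_i d 0 i = 1 ->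
    d 0 i0 = 1 -> d *m V = row i0 V.
  move=> d0 d1 di; rewrite mulD di scale1r big1 ?addr0 // => j _.
  move: d1; rewrite sumD di => /eqP; rewrite -subr_eq0 addrC addKr.
  rewrite psumr_eq0 // => /allP/(_ j (mem_index_enum _))/eqP ->.
  by rewrite scale0r.
have le1 (d : 'rV[R]_N.+1) : (forall i, 0 <= d 0 i) -> \sum_i d 0 i = 1 ->
    d 0 i0 <= 1.
  by move=> d0 <-; rewrite sumD lerDl sumr_ge0.
have [ci|ci] := eqVneq (c 0 i0) 1.
  have := le1 _ a0 a1; have := le1 _ b0 b1; move=> bi ai.
  case: nE; rewrite (only a) ?(only b) //; move: ci; rewrite cE => ci; nra.
have cl : 0 < 1 - c 0 i0 by rewrite subr_gt0 lt_neqAle ci le1.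
exists (\row_j (c 0 (lift i0 j) / (1 - c 0 i0))); split.
- by move=> j; rewrite mxE divr_ge0 // ltW.
- under eq_bigr do rewrite mxE.
  rewrite -mulr_suml; move: c1; rewrite sumD => /eqP.
  by rewrite eq_sym addrC -subr_eq => /eqP <-; rewrite divff // gt_eqF.
- apply: (@scalerI _ _ (1 - c 0 i0)); first by rewrite gt_eqF.
  rewrite scalerBl scale1r {1}vc mulD addrC addKr.
  rewrite scalemxAl mulmx_sum_row; apply: eq_bigr => j _.
  rewrite !mxE mulrC divfK ?gt_eqF //; congr (_ *: _).
  by apply/rowP => q; rewrite !mxE.
Qed.

(** Discarding a row that is not a vertex preserves the hull. Generators that are vertices are
    needed because integrality is assumed of vertices only. *)
Lemma mconv_vertices N (V : 'M[R]_(N, n)) : exists N' (W : 'M[R]_(N', n)),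
  mconv W = mconv V /\ forall i, vertices (mconv W) (row i W).
Proof.
elim: N V => [|N IH] V; first by exists 0%N, V; split=> // -[].
have [H|/existsNP[i0 /nonvertex_row H]] :=
  pselect (forall i, vertices (mconv V) (row i V)); first by exists N.+1, V.
have [N' [W [WE Wv]]] := IH (row' i0 V); exists N', W; split=> //.
rewrite WE; apply/seteqP; split; apply: mconv_sub => i.
  have -> : row i (row' i0 V) = row (lift i0 i) V.
    by apply/rowP => q; rewrite !mxE.
  exact: mconv_row.
case: (unliftP i0 i) => [j|] -> //.
have -> : row (lift i0 j) V = row j (row' i0 V).
  by apply/rowP => q; rewrite !mxE.
exact: mconv_row.
Qed.

Lemma vertices_dilate m (P : set 'rV[R]_n) v : (0 < m)%N ->
  vertices P v -> vertices (dilate m P) (m%:R *: v).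
Proof.
move=> m0 [Pv vv]; split; first by exists v.
have mN : m%:R != 0 :> R by rewrite pnatr_eq0 -lt0n.
move=> _ _ t [y Py <-] [z Pz <-] t01.
rewrite !scalerA ![_ * m%:R]mulrC -!scalerA -scalerDr => /(scalerI mN) E.
by have [-> ->] := vv y z t Py Pz t01 E.
Qed.

(** The homothety with centre [z] and ratio [t] maps [P] into itself; its inverse [f] is continuous
    and preserves the affine hull, so it pulls back the neighbourhood of [x]. *)
Lemma relint_segment (P : set 'rV[R]_n) x z (t : R) :
  (forall x y (t : R), 0 <= t <= 1 -> P x -> P y ->
    P (t *: x + (1 - t) *: y)) ->
  0 < t <= 1 -> relint P x -> P z -> relint P (t *: x + (1 - t) *: z).
Proof.
move=> Pconv /andP[t0 t1] [Px nx] Pz.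
have t01 : 0 <= t <= 1 by rewrite (ltW t0).
have tN : t != 0 by rewrite gt_eqF.
split; first exact: Pconv.
set y := _ + _.
pose f (u : 'rV[R]_n) := t^-1 *: (u - (1 - t) *: z).
have fy : f y = x by rewrite /f /y addrK scalerA mulVf // scale1r.
have fc : f u @[u --> y] --> f y.
  have h : (fun u : 'rV[R]_n => u - (1 - t) *: z) u @[u --> y]
      --> y - (1 - t) *: z.
    exact: (cvgB cvg_id (cvg_cst _)).
  exact: (cvgZl_tmp h).
have fK u : u = t *: f u + (1 - t) *: z.
  by rewrite /f scalerA divff // scale1r subrK.
rewrite /within /= in nx *.
have {nx} : nbhs (f y) [set u | affine_hull P u -> P u] by rewrite fy.
move=> /fc nf; apply: (@filterS _ (nbhs y) _ _ _ _ nf) => u /= H uA.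
rewrite (fK u); apply: Pconv => //.
apply: H; case: uA => M [v [a [vP a1 ->]]].
(* [f u] is the affine combination of [u] and [z] with weights [t^-1] and [1 - t^-1], so [z] joins
   the points that express [u]. *)
exists M.+1, (fun i => oapp v z (unlift ord0 i)),
  (fun i => oapp (fun j => t^-1 * a j) (1 - t^-1) (unlift ord0 i)); split.
- by move=> i; case: unliftP => [j|] _ //=.
- rewrite big_ord_recl unlift_none /=; under eq_bigr do rewrite liftK /=.
  by rewrite -mulr_sumr a1 mulr1 subrK.
- rewrite [RHS]big_ord_recl unlift_none /=.
  under [X in _ = _ + X]eq_bigr do rewrite liftK /= -scalerA.
  rewrite -scaler_sumr /f scalerBr scalerA mulrBr mulr1 mulVf // addrC.
  by rewrite -scaleNr opprB.
Qed.

End MatrixHull.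

(** * Counting lattice points in a cell and in the whole complex *)

Section Cells.
Local Open Scope classical_set_scope.
Variables (R : realType) (n : nat).

Lemma card_fset_set_seq (T : choiceType) (A : set T) (s : seq T) :
  uniq s -> (forall x, x \in s <-> A x) -> #|` fset_set A| = size s.
Proof.
move=> us sA.
have AE : A = [set` s] by apply/seteqP; split=> x /sA.
have fA : finite_set A by apply/finite_seqP; exists s.
apply/perm_size/uniq_perm => // x.
by rewrite in_fset_set //; apply/idP/idP => [/set_mem/sA//|/sA/mem_set].
Qed.

(* The open simplices spanned by admissible supports partition the polytope,
   and each of them is contained in the relative interior as soon as it meets
   it. *)
Lemma cell_newton (P : set 'rV[R]_n) (m l : nat) :
  (0 < m)%N -> (l < m)%N -> polytope P ->
  vertices (dilate m P) `<=` @integer_points R n ->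
  exists F : nat -> nat, newton_nat F /\ forall k, exists s : seq 'rV[R]_n,
    [/\ uniq s, size s = F k & forall x, x \in s <->
      (@integer_points R n `&` dilate (k.+1 * m + l) (relint P)) x].
Proof.
move=> m0 lm [s0 P0] Pint.
have [N [V [VE Vv]]] := mconv_vertices (\matrix_(i < size s0) s0`_i).
have {VE s0 P0} PE : P = mconv V by rewrite VE -convex_hull_mconv.
rewrite -PE in Vv.
have mN : m%:R != 0 :> R by rewrite pnatr_eq0 -lt0n.
(* The scaled vertices are integral and serve as cone generators; a coefficient sum [t / m] then
   corresponds to the dilation factor [t]. *)
pose U := m%:R *: V.
have mulU b : b *m U = m%:R *: (b *m V) by rewrite /U -scalemxAr.
have U_int i j : U i j \is a Num.int.
  have /(_ j) := Pint _ (vertices_dilate m0 (Vv i)).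
  by rewrite !mxE.
have Pconv x y (t : R) : 0 <= t <= 1 -> P x -> P y -> P (t *: x + (1 - t) *: y).
  by rewrite PE; apply: mconv_convex.
pose G : set 'rV[R]_N := [set b | [/\ nonneg b, admissible U (supp b),
  0 < \sum_i b 0 i & relint P ((\sum_i b 0 i)^-1 *: (b *m V))]].
(* Let [a] and [a'] be the normalised coefficients. With equal supports, the segment from [a] to
   [a'] can be prolonged a little to a point [z] of [P]; then [a'] gives a point strictly between a
   relative interior point and [z]. *)
have G_supp b b' : G b -> nonneg b' -> supp b' = supp b -> G b'.
  move=> [b0 bA bs br] b'0 sb.
  have b's : 0 < \sum_i b' 0 i.
    rewrite lt_def sumr_ge0 ?andbT //; apply: contraTneq bs => /eqP.
    rewrite psumr_eq0 // => /allP b'z.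
    rewrite big1 ?ltxx // => i _; apply/eqP.
    have /setP/(_ i) := sb; rewrite !inE (eqP (b'z i (mem_index_enum _))) eqxx.
    by move=> /esym/negbFE.
  split=> //; first by rewrite sb.
  pose a := (\sum_i b 0 i)^-1 *: b; pose a' := (\sum_i b' 0 i)^-1 *: b'.
  have a0 : nonneg a by move=> i; rewrite mxE mulr_ge0 // invr_ge0 ltW.
  have a'0 : nonneg a' by move=> i; rewrite mxE mulr_ge0 // invr_ge0 ltW.
  have sum1 (d : 'rV[R]_N) : 0 < \sum_i d 0 i ->
      \sum_i ((\sum_i d 0 i)^-1 *: d) 0 i = 1.
    move=> d0; under eq_bigr do rewrite mxE.
    by rewrite -mulr_sumr mulVf // gt_eqF.
  have mE (c c' : 'rV[R]_N) u i : (c - u *: c') 0 i = c 0 i - u * c' 0 i.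
    by rewrite !mxE.
  have [|e e0 ae] := @exists_small_step _ _ a' (- a) a'0.
    move=> i; rewrite mxE oppr_lt0 => ai.
    have : i \in supp b.
      rewrite inE; apply: contraTneq ai; rewrite mxE => ->.
      by rewrite mulr0 ltxx.
    rewrite -sb -nonneg_supp // => b'i.
    by rewrite mxE mulr_gt0 // invr_gt0.
  (* The bound [e] keeps [a' - t *: a] nonnegative, and the bound 1/2 keeps [1 - t] positive. *)
  pose t := Num.min e 2^-1.
  have t0 : 0 < t by rewrite lt_min e0 invr_gt0 ltr0n.
  have t1 : t < 1 by rewrite gt_min invf_lt1 ?ltr1n ?orbT // ltr0n.
  have te : t <= e by rewrite ge_min lexx.
  have u0 : 0 < 1 - t by rewrite subr_gt0.
  pose z := ((1 - t)^-1 *: (a' - t *: a)) *m V.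
  have Pz : P z.
    rewrite PE; exists ((1 - t)^-1 *: (a' - t *: a)); split=> //.
      move=> i; rewrite mxE mulr_ge0 ?invr_ge0 ?(ltW u0) //.
      have := ae i; have := a0 i; rewrite scalerN !mE.
      move: (a 0 i) (a' 0 i) => p q p0 qe.
      have : t * p <= e * p by rewrite ler_wpM2r.
      lra.
    under eq_bigr do rewrite mxE mE.
    rewrite -mulr_sumr big_split sumrN -mulr_sumr /= !sum1 // mulr1 mulVf //.
    by rewrite gt_eqF.
  have -> : (\sum_i b' 0 i)^-1 *: (b' *m V) =
      t *: ((\sum_i b 0 i)^-1 *: (b *m V)) + (1 - t) *: z.
    have -> : (1 - t) *: z = a' *m V - t *: (a *m V).
      rewrite /z -scalemxAl scalerA divff ?gt_eqF // scale1r mulmxBl.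
      by congr (_ - _); rewrite scalemxAl.
    by rewrite /a /a' -!scalemxAl addrC subrK.
  by apply: relint_segment => //; rewrite t0 ltW.
have G_inj b b' : G b -> G b' ->
    b *m U = b' *m U -> \sum_i b 0 i = \sum_i b' 0 i -> b = b'.
  by move=> [b0 bA _ _] [b'0 b'A _ _]; apply: (admissible_inj b0 b'0 bA b'A).
have [||F [Fn Fs]] := points_of_height_newton m0 lm U_int _ _ G_supp G_inj.
- by move=> b [].
- by move=> b [].
exists F; split=> // k; have [s [us ss sP]] := Fs k; exists s; split=> // x.
rewrite sP; have tN : (k.+1 * m + l)%N%:R != 0 :> R.
  by rewrite pnatr_eq0 -lt0n addn_gt0 muln_gt0 m0.
have t0 : 0 < (k.+1 * m + l)%N%:R :> R by rewrite lt_def tN ler0n.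
move: (k.+1 * m + l)%N tN t0 => t tN t0.
split=> -[xI].
  move=> [b [[b0 bA bs br] bU bt]]; split=> //; rewrite -bU.
  exists ((\sum_i b 0 i)^-1 *: (b *m V)) => //.
  by rewrite mulU scalerA -bt mulfK // gt_eqF.
move=> [y yr xE]; split=> //.
have [a [a0 a1 yE]] : mconv V y by rewrite -PE; case: yr.
have b0 : nonneg ((t%:R / m%:R) *: a).
  by move=> i; rewrite mxE mulr_ge0 // divr_ge0.
have [b [[b'0 bU bs] bA]] := exists_admissible U b0.
have {}bs : \sum_i b 0 i = t%:R / m%:R.
  by rewrite bs; under eq_bigr do rewrite mxE; rewrite -mulr_sumr a1 mulr1.
have {}bU : b *m U = x.
  by rewrite bU mulU -scalemxAl -yE scalerA mulrC divfK // xE.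
exists b; split=> //; last by rewrite bs mulrC divfK.
split=> //; first by rewrite bs divr_gt0 // ltr0n.
suff -> : (\sum_i b 0 i)^-1 *: (b *m V) = y by [].
apply: (@scalerI _ _ t%:R) => //.
by rewrite xE -bU mulU scalerA bs invf_div mulrC divfK.
Qed.

(** Scaling by a nonzero factor is injective, so the dilated relative interiors stay disjoint and
    the counts of the cells add up. *)
Lemma ehrhart_newton (K : partial_polytopal_complex R n) (m l : nat) :
  (0 < m)%N -> (l < m)%N -> integral_dilate K m ->
  newton_nat (fun k => ehrhart K (k.+1 * m + l)).
Proof.
move=> m0 lm Kint.
have /choice[F FP] i := cell_newton m0 lm (@cell_polytope _ _ K i) (Kint i).
have [f fP] : newton_nat (fun k => \sum_(i < ncells K) F i k)%N.
  by apply: newton_nat_sum => i; case: (FP i).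
exists f => k; rewrite -fP.
have /choice[s sP] i := (FP i).2 k.
have tN : (k.+1 * m + l)%N%:R != 0 :> R.
  by rewrite pnatr_eq0 -lt0n addn_gt0 muln_gt0 m0.
rewrite /ehrhart; move: (k.+1 * m + l)%N tN sP => t tN sP.
rewrite (@card_fset_set_seq _ _ [seq x | i <- enum 'I_(ncells K), x <- s i]).
- rewrite size_allpairs_dep sumnE big_map big_enum /=.
  by apply: eq_bigr => i _; case: (sP i).
- apply: allpairs_uniq_dep; first exact: enum_uniq.
    by move=> i _; case: (sP i).
  move=> [i x] [j y] /allpairsPdep[i' [x' [_ xi [-> ->]]]].
  move=> /allpairsPdep[j' [y' [_ yj [-> ->]]]] /= E; subst y'.
  have [_ _ /(_ x')[/(_ xi)[_ [p pi px]] _]] := sP i'.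
  have [_ _ /(_ x')[/(_ yj)[_ [q qj qx]] _]] := sP j'.
  have pq : p = q by apply: (scalerI tN); rewrite px qx.
  subst q; suff -> : i' = j' by [].
  by apply: (@cell_disjoint _ _ K) => //; exists p.
- move=> x; split.
    move=> /allpairsPdep[i [y [_ yi ->]]].
    have [_ _ /(_ y)[/(_ yi)[yI [p pi px]] _]] := sP i.
    by split=> //; exists p => //; exists i.
  move=> [xI [p [i _ pi] px]]; apply/allpairsPdep; exists i, x; split=> //.
    by rewrite mem_enum.
  by have [_ _ sx] := sP i; apply/sx; split=> //; exists p.
Qed.

End Cells.

Theorem theorem1p6 (R : realType) (n : nat)
    (K : partial_polytopal_complex R n) (d m : nat) (p : 'I_m -> {poly R})
    (K_rational : rational_complex K)
    (K_dim : complex_dim K d)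
    (m_gt0 : (0 < m)%N)
    (mK_integral : integral_dilate K m)
    (p_degree : forall l : 'I_m, (size (p l) <= d.+1)%N)
    (p_ehrhart : forall (k : nat) (l : 'I_m),
      (k, nat_of_ord l) <> (0%N, 0%N) ->
      (ehrhart K (k * m + l)%N)%:R = (p l).[k%:R]) :
  forall (i : 'I_d.+1) (l : 'I_m), fstar (p l) d ord0 i \is a Num.nat.
Proof.
move=> i l.
apply: (fstar_nat (p_degree l) (ehrhart_newton m_gt0 (ltn_ord l) mK_integral)).
(* The pair [(k.+1, l)] is never the excluded [(0, 0)]. *)
by move=> k; rewrite p_ehrhart.
Qed.
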